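(* Let $\bar c\in\mathcal C$ be a null vertex of $\operatorname{conv}(\mathcal C)$. Then $\operatorname{conv}(\frac12(d+\mathcal W))$ lies in the closed half-space $\{\bar x: J(\bar c,\bar x)\ge0\}$.
   Context: Setting: $G$ compact Lie group, $K\subset G$ closed, $G/K$ connected almost effective, isotropy representation $\mathfrak p=\mathfrak p_1\oplus\cdots\oplus\mathfrak p_r$ ($r\ge2$) with pairwise inequivalent $\mathbb R$-irreducible summands, $d_i=\dim\mathfrak p_i$, $d=(d_1,\dots,d_r)$, $n=\sum d_i$. The scalar curvature of the metric $e^{q_i}Q$ on $\mathfrak p_i$ is $S(q)=\sum_{w\in\mathcal W}A_we^{w\cdot q}$, $\mathcal W\subset\mathbb Z^r$ finite, $A_w\ne0$, each $w$ of type I (one entry $-1$), type II (one entry $1$, two entries $-1$) or type III (one entry $1$, one entry $-2$), other entries $0$; $A_w>0$ for type I and $<0$ otherwise. Assume $\dim\operatorname{conv}(\mathcal W)=r-1$. $J$ is the symmetric bilinear form with $J(p,p)=\frac1{n-1}(\sum p_i)^2-\sum p_i^2/d_i$; null means $J(\bar x,\bar x)=0$. $u=\sum_{\bar c\in\mathcal C}F_{\bar c}e^{\bar c\cdot q}$ ($\mathcal C$ finite, $F_{\bar c}\ne0$) is a superpotential: for every $\xi$, $\sum_{(\bar a,\bar c)\in\mathcal C^2,\ \bar a+\bar c=\xi}J(\bar a,\bar c)F_{\bar a}F_{\bar c}$ equals $A_w$ if $\xi=d+w$, $w\in\mathcal W$, and $0$ otherwise; $\mathcal C$ is normalised to lie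 in $\{\sum\bar x_i=\frac12(n-1)\}$. *)

(* Defs.v *)
From HB Require Import structures.
From mathcomp Require Import all_boot all_order all_algebra.
From mathcomp Require Import reals.
Set Implicit Arguments. Unset Strict Implicit. Unset Printing Implicit Defensive.
Import Order.TTheory GRing.Theory Num.Theory.
Local Open Scope ring_scope.

Section Defs.
Variables (R : realType) (r : nat).

Definition dvec (d : 'I_r -> nat) : 'rV[R]_r := \row_i (d i)%:R.

Definition ndim (d : 'I_r -> nat) : nat := (\sum_(i < r) d i)%N.

Definition intvec (w : 'rV[int]_r) : 'rV[R]_r := map_mx (fun z : int => z%:~R) w.

Definition Jform (d : 'I_r -> nat) (p q : 'rV[R]_r) : R :=
  (\sum_(i < r) p ord0 i) * (\sum_(i < r) q ord0 i) / ((ndim d)%:R - 1)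
  - \sum_(i < r) p ord0 i * q ord0 i / (d i)%:R.

Definition in_conv (S : seq 'rV[R]_r) (x : 'rV[R]_r) : Prop :=
  exists lam : 'I_(size S) -> R,
    [/\ forall k, 0 <= lam k, \sum_k lam k = 1 &
        x = \sum_k lam k *: S`_k].

Definition is_vertex_conv (S : seq 'rV[R]_r) (c : 'rV[R]_r) : Prop :=
  in_conv S c /\
  forall (x y : 'rV[R]_r) (t : R), in_conv S x -> in_conv S y ->
    0 < t < 1 -> c = t *: x + (1 - t) *: y -> x = c /\ y = c.

Definition affdim (W : seq 'rV[int]_r) : nat :=
  \rank (\matrix_(k < size W, j < r) (intvec W`_k - intvec W`_0) ord0 j).

(* the superpotential identity for the coefficient at xi *)
Definition conv_coef (d : 'I_r -> nat) (C : seq 'rV[R]_r) (F : 'rV[R]_r -> R)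
  (xi : 'rV[R]_r) : R :=
  \sum_(a <- C) \sum_(c <- C | a + c == xi) Jform d a c * F a * F c.

End Defs.

Definition typeI (r : nat) (w : 'rV[int]_r) : Prop :=
  exists i : 'I_r, w ord0 i = -1 /\ forall j, j != i -> w ord0 j = 0.
Definition typeII (r : nat) (w : 'rV[int]_r) : Prop :=
  exists i j k : 'I_r, i != j /\ i != k /\ j != k /\
    w ord0 i = 1 /\ w ord0 j = -1 /\ w ord0 k = -1 /\
    (forall l, l != i -> l != j -> l != k -> w ord0 l = 0).
Definition typeIII (r : nat) (w : 'rV[int]_r) : Prop :=
  exists i j : 'I_r, [/\ i != j, w ord0 i = 1, w ord0 j = -2 &
    forall l, l != i -> l != j -> w ord0 l = 0].

(* Main.v *)
(* Suppose J(c, d + w) < 0 for some w in W. Since d + w is a sum of two points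
   of C, conv(C) has an edge from its vertex c, in some direction b, along which
   J(c, .) < 0; as J(c, c) = 0 and J(b, b) <= 0, J is negative on all pairs of
   points of C on the edge except (c, c). Let p be the point of C on the edge
   nearest to c, q the farthest and m the second farthest. The sums c + p, m + q
   and q + q have essentially unique representations in C + C, so their
   superpotential coefficients do not vanish and they are d + w0, d + w1, d + w2
   with w0, w1, w2 in W, at parameters 0 < s0 <= s1 < s2 on the half-line
   V + s b, where V = 2c - d. Finally J(c, b) < 0 means that
   sum_i V_i b_i / d_i > 0, so V_i and b_i have the same sign for some i, which is
   impossible for integers w0_i, w1_i, w2_i in [-2, 1]. *)
Require Import Defs.
From HB Require Import structures.
From mathcomp Require Import all_boot all_order all_algebra.
From mathcomp Require Import reals.
From mathcomp Require Import zify ring lra.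
Import Order.TTheory GRing.Theory Num.Theory.
Local Open Scope ring_scope.
Set Implicit Arguments. Unset Strict Implicit. Unset Printing Implicit Defensive.

(** * Extrema over finite families *)

Lemma seq_argmax (R : realDomainType) (T : eqType) (h : T -> R) (s : seq T) (x0 : T) :
  x0 \in s -> exists2 x, x \in s & forall y, y \in s -> h y <= h x.
Proof.
elim: s x0 => // a s IH x0 _.
case: s IH => [_|b s IH].
  by exists a; rewrite ?mem_head // => y; rewrite inE => /eqP ->.
have [x xs hx] := IH b (mem_head _ _).
have [hax|hxa] := leP (h a) (h x).
  exists x; first by rewrite inE xs orbT.
  by move=> y; rewrite inE => /orP[/eqP ->//|]; apply: hx.
exists a; first exact: mem_head.
move=> y; rewrite inE => /orP[/eqP ->//|/hx]; move: hxa; lra.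
Qed.

Lemma exists_strict_upper (R : realFieldType) (T : eqType) (h : T -> R) (s : seq T) :
  exists t, forall x, x \in s -> h x < t.
Proof.
case: s => [|a s]; first by exists 0.
have [x _ hx] := seq_argmax h (mem_head a s).
by exists (h x + 1) => y /hx; lra.
Qed.

Lemma exists_between (R : realFieldType) (T : eqType) (h : T -> R) (s : seq T) (U : R) :
  (forall x, x \in s -> h x < U) ->
  exists2 t, t < U & forall x, x \in s -> h x < t.
Proof.
case: s => [|a s] hU; first by exists (U - 1); [lra|].
have [x xs hx] := seq_argmax h (mem_head a s).
have := hU x xs => hxU.
by exists ((h x + U) / 2); [lra|move=> y /hx; lra].
Qed.

(** * Linear inequalities and extremal rays in Euclidean space *)

Section Dot.
Variables (R : realFieldType) (r : nat).
Implicit Types u v w : 'rV[R]_r.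

Definition dot u v : R := \sum_i u ord0 i * v ord0 i.

Lemma dotC u v : dot u v = dot v u.
Proof. by apply: eq_bigr => i _; rewrite mulrC. Qed.

Lemma dotDr u v w : dot u (v + w) = dot u v + dot u w.
Proof. by rewrite -big_split; apply: eq_bigr => i _; rewrite mxE mulrDr. Qed.

Lemma dotZr u (t : R) v : dot u (t *: v) = t * dot u v.
Proof. by rewrite mulr_sumr; apply: eq_bigr => i _; rewrite mxE mulrCA. Qed.

Lemma dotNr u v : dot u (- v) = - dot u v.
Proof. by rewrite -scaleN1r dotZr mulN1r. Qed.

Lemma dotBr u v w : dot u (v - w) = dot u v - dot u w.
Proof. by rewrite dotDr dotNr. Qed.

Lemma dotDl u v w : dot (u + v) w = dot u w + dot v w.
Proof. by rewrite dotC dotDr !(dotC w). Qed.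

Lemma dotZl (t : R) u v : dot (t *: u) v = t * dot u v.
Proof. by rewrite dotC dotZr dotC. Qed.

Lemma dotBl u v w : dot (u - v) w = dot u w - dot v w.
Proof. by rewrite dotC dotBr !(dotC w). Qed.

Lemma dot0r u : dot u 0 = 0.
Proof. by rewrite -(scale0r (0 : 'rV[R]_r)) dotZr mul0r. Qed.

Lemma dot_ge0 u : 0 <= dot u u.
Proof. by apply: sumr_ge0 => i _; rewrite -expr2 sqr_ge0. Qed.

Lemma dot_eq0 u : dot u u = 0 -> u = 0.
Proof.
move=> /eqP; rewrite psumr_eq0; last by move=> i _; rewrite -expr2 sqr_ge0.
move=> /allP h; apply/rowP => i; rewrite mxE.
by have /eqP := h i (mem_index_enum i); move/eqP; rewrite mulf_eq0 orbb => /eqP.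
Qed.

(* Gordan's alternative, with the convex cone spanned by [B] replaced by an
   arbitrary convex cone [K] (possibly without apex) containing it. *)
Lemma gordan (K : 'rV[R]_r -> Prop) (B : seq 'rV[R]_r) :
  (forall u v, K u -> K v -> K (u + v)) ->
  (forall t u, 0 < t -> K u -> K (t *: u)) ->
  (forall b, b \in B -> K b) ->
  (exists f, forall b, b \in B -> 0 < dot f b) \/ K 0.
Proof.
move=> KD KZ; have [n] := ubnP (size B).
elim: n B => // n IH [|b0 B] szB KB; first by left; exists 0.
have Kb0 : K b0 by apply: KB; apply: mem_head.
have KB' b : b \in B -> K b by move=> bB; apply: KB; rewrite inE bB orbT.
have [[f fB]|] := IH B szB KB'; last by right.
have [f0|f0|f0] := ltgtP (dot f b0) 0; last 1 first.
(* [b0] pairs positively with itself, and a large multiple of [f] corrects the signs on [B] without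
   changing the value at [b0]. *)
- have [b00|b00] := eqVneq b0 0; first by right; rewrite -b00.
  have b0b0 : 0 < dot b0 b0.
    rewrite lt_neqAle dot_ge0 andbT eq_sym.
    by apply/eqP => /dot_eq0 /eqP; apply/negP.
  have [t ht] := exists_strict_upper (fun b => - dot b0 b / dot f b) B.
  left; exists (b0 + t *: f) => b; rewrite dotDl dotZl inE => /orP[/eqP ->|bB].
    by rewrite f0 mulr0 addr0.
  by have := ht b bB; rewrite ltr_pdivrMr ?fB //; lra.
(* [h b] is the positive combination of [b0] and [b] killed by [f]. Positivity of [g] on it says
   that the lower bound [b] puts on [t] is below the upper bound put by [b0]. *)
- pose h b := dot f b *: b0 - dot f b0 *: b.
  have [|b|[g gB]|] := IH (map h B); rewrite ?size_map //; last by right.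
    move=> /mapP[b' b'B ->]; apply: KD; first exact: KZ (fB _ b'B) Kb0.
    by rewrite -scaleNr; apply: KZ (KB' _ b'B); rewrite oppr_gt0.
  have [b bB|t tU ht] :=
    @exists_between _ _ (fun b => - dot g b / dot f b) B (dot g b0 / - dot f b0).
    have := gB _ (map_f h bB); rewrite /h dotBr !dotZr => gb.
    have fb := fB b bB; rewrite ltr_pdivrMr // mulrAC ltr_pdivlMr; lra.
  left; exists (g + t *: f) => b; rewrite dotDl dotZl inE => /orP[/eqP ->|bB].
    by move: tU; rewrite ltr_pdivlMr ?oppr_gt0 //; lra.
  by have := ht b bB; rewrite ltr_pdivrMr ?fB //; lra.
- left; exists f => b; rewrite inE => /orP[/eqP -> //|]; exact: fB.
Qed.

(* Among the directions [x - c], scaled to [f]-height one, take one maximising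
   [g] and then the Euclidean norm: by strict convexity it is an extreme point
   of the slice. *)
Lemma extremal_ray (C : seq 'rV[R]_r) (c f g : 'rV[R]_r) :
  (forall a, a \in C -> a != c -> 0 < dot f (a - c)) ->
  (exists2 a, a \in C & 0 < dot g (a - c)) ->
  exists2 b, dot f b = 1 /\ 0 < dot g b &
    (exists e, [/\ e \in C, e != c & e - c = dot f (e - c) *: b]) /\
    forall x y t, x \in C -> y \in C -> (x - c) + (y - c) = t *: b ->
      x - c = dot f (x - c) *: b /\ y - c = dot f (y - c) *: b.
Proof.
move=> fC [a aC ga].
pose u x := (dot f (x - c))^-1 *: (x - c).
have ac : a != c by apply: contraTneq ga => ->; rewrite subrr dot0r ltxx.
pose C1 := [seq x <- C | x != c].
have aC1 : a \in C1 by rewrite mem_filter ac.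
have fC1 x : x \in C1 -> 0 < dot f (x - c).
  by rewrite mem_filter => /andP[xc xC]; apply: fC.
have uE x : x \in C1 -> x - c = dot f (x - c) *: u x.
  by move=> /fC1 fx; rewrite scalerA divff ?scale1r // gt_eqF.
have [e1 e1C1 e1max] := seq_argmax (fun x => dot g (u x)) aC1.
pose C2 := [seq x <- C1 | dot g (u x) == dot g (u e1)].
have e1C2 : e1 \in C2 by rewrite mem_filter eqxx.
have [e eC2 emax] := seq_argmax (fun x => dot (u x) (u x)) e1C2.
move: (eC2); rewrite mem_filter => /andP[/eqP ge eC1].
have gemax x : x \in C1 -> dot g (u x) <= dot g (u e) by rewrite ge; apply: e1max.
have {}emax x : x \in C1 -> dot g (u x) = dot g (u e) ->
    dot (u x) (u x) <= dot (u e) (u e).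
  by move=> xC1 gx; apply: emax; rewrite mem_filter gx ge eqxx.
have fu x : x \in C1 -> dot f (u x) = 1.
  by move=> /fC1 fx; rewrite dotZr mulVf // gt_eqF.
exists (u e).
  split; first exact: fu.
  apply: lt_le_trans (gemax a aC1).
  by rewrite dotZr mulr_gt0 // invr_gt0 fC1.
split.
  by exists e; move: (eC1); rewrite mem_filter => /andP[ec eC]; split=> //; apply: uE.
move=> x y t xC yC.
have [->|xc] := eqVneq x c.
  rewrite subrr add0r dot0r scale0r => ->; split=> //.
  by rewrite dotZr fu // mulr1.
have [->|yc] := eqVneq y c.
  rewrite subrr addr0 dot0r scale0r => ->; split=> //.
  by rewrite dotZr fu // mulr1.
have xC1 : x \in C1 by rewrite mem_filter xc.
have yC1 : y \in C1 by rewrite mem_filter yc.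
have fx := fC1 x xC1; have fy := fC1 y yC1.
move=> E.
suff [ux uy] : u x = u e /\ u y = u e by rewrite -{1}ux -uy -!uE.
have {}E : dot f (x - c) *: u x + dot f (y - c) *: u y = t *: u e by rewrite -!uE.
move: E (fu x xC1) (fu y yC1) (fu e eC1).
move: (gemax x xC1) (gemax y yC1) (emax x xC1) (emax y yC1) fx fy.
move: (u x) (u y) (u e) (dot f (x - c)) (dot f (y - c)).
move=> v w z p q gv gw nv nw p0 q0 E fv fw fz.
have tE : t = p + q.
  by have := congr1 (dot f) E; rewrite dotDr !dotZr fv fw fz; lra.
have gE : p * (dot g z - dot g v) + q * (dot g z - dot g w) = 0.
  by have := congr1 (dot g) E; rewrite dotDr !dotZr tE; lra.
have /nv {}nv : dot g v = dot g z by nra.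
have /nw {}nw : dot g w = dot g z by nra.
(* [z] is a weighted mean of [v] and [w], neither of which is longer than [z], so expanding the
   squares leaves nothing positive. *)
have NE : p * dot (v - z) (v - z) + q * dot (w - z) (w - z) <= 0.
  have := congr1 (dot z) E; rewrite dotDr !dotZr tE.
  rewrite !dotBr !dotBl !(dotC _ z).
  have : p * dot v v <= p * dot z z by rewrite ler_pM2l.
  have : q * dot w w <= q * dot z z by rewrite ler_pM2l.
  lra.
have v0 := dot_ge0 (v - z); have w0 := dot_ge0 (w - z).
have /dot_eq0/eqP : dot (v - z) (v - z) = 0 by nra.
have /dot_eq0/eqP : dot (w - z) (w - z) = 0 by nra.
by rewrite !subr_eq0 => /eqP -> /eqP ->.
Qed.

End Dot.

(** * Vertices of convex hulls and uniquely represented sums *)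

Section Convexity.
Variables (R : realType) (r : nat).
Implicit Types (C : seq 'rV[R]_r) (x y c : 'rV[R]_r).

Lemma mem_in_conv C x : x \in C -> in_conv C x.
Proof.
move=> xC; have ix : (index x C < size C)%N by rewrite index_mem.
exists (fun k => (k == Ordinal ix)%:R); split.
- by move=> k; rewrite ler0n.
- by rewrite (bigD1 (Ordinal ix)) //= eqxx big1 ?addr0 // => k /negbTE ->.
rewrite (bigD1 (Ordinal ix)) //= eqxx scale1r nth_index // big1 ?addr0 //.
by move=> k /negbTE ->; rewrite scale0r.
Qed.

Lemma in_conv_convex C x y (t : R) : 0 <= t <= 1 ->
  in_conv C x -> in_conv C y -> in_conv C (t *: x + (1 - t) *: y).
Proof.
move=> /andP[t0 t1] [l [l0 l1 ->]] [m [m0 m1 ->]].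
exists (fun k => t * l k + (1 - t) * m k); split.
- by move=> k; rewrite addr_ge0 ?mulr_ge0 ?subr_ge0.
- by rewrite big_split /= -!mulr_sumr l1 m1; lra.
rewrite !scaler_sumr -big_split /=; apply: eq_bigr => k _.
by rewrite !scalerA scalerDl.
Qed.

(** Gordan's alternative for the cone over [conv(C)] seen from [c]. Extremality of [c] makes this
    cone closed under addition even though its apex is left out, so it is convex and misses 0. *)
Lemma vertex_supporting C c : is_vertex_conv C c ->
  exists f, forall a, a \in C -> a != c -> 0 < dot f (a - c).
Proof.
move=> [cC cV].
pose K z := exists t y, [/\ 0 < t, in_conv C y, y <> c & z = t *: (y - c)].
have [] := @gordan _ _ K [seq a - c | a <- C & a != c].
- move=> _ _ [t [x [t0 xC xc ->]]] [s [y [s0 yC yc ->]]].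
  have ts : 0 < t + s by lra.
  pose k := t / (t + s).
  have k0 : 0 < k by rewrite divr_gt0.
  have k1 : k < 1 by rewrite ltr_pdivrMr //; lra.
  exists (t + s), (k *: x + (1 - k) *: y); split=> //.
  + by apply: in_conv_convex => //; lra.
  + move=> E; have kk : 0 < k < 1 by rewrite k0.
    by have [/xc] := cV x y k xC yC kk (esym E).
  + by apply/rowP => i; rewrite !mxE /k; field; lra.
- move=> s _ s0 [t [y [t0 yC yc ->]]].
  by exists (s * t), y; rewrite scalerA mulr_gt0.
- move=> _ /mapP[a + ->]; rewrite mem_filter => /andP[/eqP ac aC].
  by exists 1, a; rewrite scale1r; split=> //; apply: mem_in_conv.
- move=> [f fC]; exists f => a aC ac; apply: fC.
  by apply: map_f; rewrite mem_filter ac.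
- move=> [t [y [t0 yC yc /esym/eqP]]].
  by rewrite scaler_eq0 gt_eqF //= subr_eq0 => /eqP /yc.
Qed.

(** Only the pairs [(a, b)] and [(b, a)] contribute, with equal terms by symmetry. Letting [k] count
    them treats [a = b] and [a <> b] together and excludes cancellation. *)
Lemma conv_coef_unique (d : 'I_r -> nat) C (F : 'rV[R]_r -> R) (a b : 'rV[R]_r) :
  (forall x y, x \in C -> y \in C -> x + y = a + b ->
     (x = a /\ y = b) \/ (x = b /\ y = a)) ->
  exists k, conv_coef d C F (a + b) = (Jform d a b * F a * F b) * k%:R /\
    (a \in C -> b \in C -> (0 < k)%N).
Proof.
move=> ab; exists (\sum_(x <- C) \sum_(y <- C | (x + y == a + b)%R) 1)%N; split.
  rewrite /conv_coef natr_sum mulr_sumr; apply: eq_big_seq => x xC.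
  rewrite natr_sum mulr_sumr big_seq_cond [RHS]big_seq_cond.
  apply: eq_bigr => y /andP[yC /eqP /(ab _ _ xC yC)] [[-> ->]|[-> ->]].
    by rewrite mulr1.
  rewrite mulr1 -!mulrA (mulrC (F b)); congr (_ * _).
  rewrite /Jform; congr (_ / _ - _); first exact: mulrC.
  by apply: eq_bigr => i _; congr (_ / _); apply: mulrC.
move=> aC bC; rewrite (big_rem a) //= (big_rem b) //= eqxx; lia.
Qed.

End Convexity.

(* [V] and [b] having the same sign, [w0], [w1], [w2] move away from [0]; in
   [-2, 1] they can only be [-1, -1, -2], and then [V = 2 w0 - w2 = 0]. *)
Lemma no_integer_progression (R : realDomainType) (V b p s t : R) (w0 w1 w2 : int) :
  0 < p -> p <= s -> s < t -> (s = p -> t = p * 2) -> 0 < V * b ->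
  w0%:~R = V + p * b -> w1%:~R = V + s * b -> w2%:~R = V + t * b ->
  -2 <= w2 -> w2 <= 1 -> False.
Proof.
move=> p0 ps st sp Vb E0 E1 E2 w2l w2u.
have [b0|b0|b0] := ltgtP b 0; last by rewrite b0 mulr0 ltxx in Vb.
- have V0 : V < 0 by nra.
  have w00 : w0 < 0 by rewrite -(ltr_int R) E0; nra.
  have w10 : w1 <= w0 by rewrite -(ler_int R) E0 E1; nra.
  have w21 : w2 < w1 by rewrite -(ltr_int R) E2 E1; nra.
  have [W0 W1 W2] : [/\ w0 = -1, w1 = -1 & w2 = -2] by split; lia.
  subst w0 w1 w2.
  have sE : s = p by nra.
  move: E0 E2; rewrite (sp sE); nra.
- have V0 : 0 < V by nra.
  have w00 : 0 < w0 by rewrite -(ltr_int R) E0; nra.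
  have w20 : w0 < w2 by rewrite -(ltr_int R) E2 E0; nra.
  lia.
Qed.

Lemma type_bounds (r : nat) (w : 'rV[int]_r) i :
  typeI w \/ typeII w \/ typeIII w -> -2 <= w ord0 i <= 1.
Proof.
case=> [[j [wj w0]]|[[j [k [l [jk [jl [kl [wj [wk [wl w0]]]]]]]]]|[j [k [jk wj wk w0]]]]].
- by have [->|/w0 ->//] := eqVneq i j; rewrite wj.
- have [->|ij] := eqVneq i j; first by rewrite wj.
  have [->|ik] := eqVneq i k; first by rewrite wk.
  by have [->|il] := eqVneq i l; rewrite ?wl ?w0.
- have [->|ij] := eqVneq i j; first by rewrite wj.
  by have [->|ik] := eqVneq i k; rewrite ?wk ?w0.
Qed.

(** * The bilinear form J on vectors of coordinate sum zero *)

Section Jform.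
Variables (R : realType) (r : nat) (d : 'I_r -> nat).
Implicit Types (p q x y : 'rV[R]_r).

(** Represents the diagonal part of J, so that on vectors of coordinate sum zero J becomes minus a
    Euclidean pairing. *)
Definition J_dual (p : 'rV[R]_r) : 'rV[R]_r := \row_i (p ord0 i / (d i)%:R).

Lemma JformE p q : Jform d p q =
  (\sum_i p ord0 i) * (\sum_i q ord0 i) / ((ndim d)%:R - 1) - dot (J_dual p) q.
Proof. by congr (_ - _); apply: eq_bigr => i _; rewrite mxE mulrAC. Qed.

Lemma JformC p q : Jform d p q = Jform d q p.
Proof.
rewrite /Jform [X in X / _]mulrC; congr (_ - _).
by apply: eq_bigr => i _; congr (_ / _); apply: mulrC.
Qed.

Lemma sum_rowD p q : \sum_i (p + q) ord0 i = \sum_i p ord0 i + \sum_i q ord0 i.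
Proof. by rewrite -big_split; apply: eq_bigr => i _; rewrite mxE. Qed.

Lemma sum_rowZ (t : R) p : \sum_i (t *: p) ord0 i = t * \sum_i p ord0 i.
Proof. by rewrite mulr_sumr; apply: eq_bigr => i _; rewrite mxE. Qed.

Lemma JformDr p x y : Jform d p (x + y) = Jform d p x + Jform d p y.
Proof. by rewrite !JformE sum_rowD dotDr; ring. Qed.

Lemma JformZr (t : R) p x : Jform d p (t *: x) = t * Jform d p x.
Proof. by rewrite !JformE sum_rowZ dotZr; ring. Qed.

Lemma JformDl p x y : Jform d (x + y) p = Jform d x p + Jform d y p.
Proof. by rewrite !(JformC _ p) JformDr. Qed.

Lemma JformZl (t : R) p x : Jform d (t *: x) p = t * Jform d x p.
Proof. by rewrite !(JformC _ p) JformZr. Qed.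

Lemma Jform_sum0 p x : \sum_i x ord0 i = 0 -> Jform d p x = - dot (J_dual p) x.
Proof. by move=> x0; rewrite JformE x0; ring. Qed.

Lemma Jform_sum0_le0 x : \sum_i x ord0 i = 0 -> Jform d x x <= 0.
Proof.
move=> x0; rewrite Jform_sum0 // oppr_le0; apply: sumr_ge0 => i _.
by rewrite mxE mulrAC mulr_ge0 ?invr_ge0 // -expr2 sqr_ge0.
Qed.

End Jform.

(** * The edge on the negative side and its three exponents *)

Unset Implicit Arguments.
Theorem theorem4p1 (R : realType) (r : nat) (d : 'I_r -> nat)
  (W : seq 'rV[int]_r) (A : 'rV[int]_r -> R)
  (C : seq 'rV[R]_r) (F : 'rV[R]_r -> R) (c : 'rV[R]_r) :
  (2 <= r)%N ->
  (forall i, (0 < d i)%N) ->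
  (* the exponent set W and the coefficients of the scalar curvature *)
  uniq W ->
  (forall w, w \in W ->
     [/\ A w != 0,
         typeI w -> 0 < A w,
         typeII w \/ typeIII w -> A w < 0 &
         typeI w \/ typeII w \/ typeIII w]) ->
  affdim R W = r.-1 ->
  (* the superpotential u *)
  uniq C ->
  (forall a, a \in C -> F a != 0) ->
  (forall a, a \in C -> \sum_(i < r) a ord0 i = ((ndim d)%:R - 1) / 2) ->
  (forall w, w \in W -> conv_coef d C F (dvec R d + intvec R w) = A w) ->
  (forall xi, (forall w, w \in W -> xi != dvec R d + intvec R w) ->
     conv_coef d C F xi = 0) ->
  (* c is a null vertex of conv(C) *)
  c \in C -> Jform d c c = 0 -> is_vertex_conv C c ->
  forall x, in_conv [seq 2^-1 *: (dvec R d + intvec R w) | w <- W] x ->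
    0 <= Jform d c x.
Proof.
move=> _ d_gt0 _ WA _ _ F0 sumC coefW coef0 cC Jcc cV.
suff Jw w : w \in W -> 0 <= Jform d c (dvec R d + intvec R w).
  move=> x [lam [lam0 _ ->]]; apply: (big_ind (fun y => 0 <= Jform d c y)) => [|y z|k _].
  - by rewrite -(scale0r c) JformZr mul0r.
  - by rewrite JformDr; apply: addr_ge0.
  - have kW : (k < size W)%N.
      by rewrite -(size_map (fun w => 2^-1 *: (dvec R d + intvec R w))).
    rewrite JformZr mulr_ge0 // (nth_map 0) // JformZr mulr_ge0 ?Jw ?mem_nth //.
    by rewrite invr_ge0 ler0n.
move=> wW; rewrite leNgt; apply/negP => Jw.
have sumB a : a \in C -> \sum_i (a - c) ord0 i = 0.
  by move=> aC; rewrite -scaleN1r sum_rowD sum_rowZ !sumC //; lra.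
have JcB a : a \in C -> dot (J_dual d c) (a - c) = - Jform d c a.
  move=> aC; rewrite -[LHS]opprK -Jform_sum0 ?sumB //.
  by rewrite -scaleN1r JformDr JformZr Jcc; ring.
have [f fC] := vertex_supporting cV.
(* If [a + b] is [d + w], then J with [c] is negative at [a] or at [b]. Without such a pair the
   coefficient would be an empty sum, against [A w != 0]. *)
have : exists2 a, a \in C & 0 < dot (J_dual d c) (a - c).
  have [/hasP[a aC /hasP[b bC /eqP ab]]|/hasPn nab] :=
      boolP (has (fun a => has (fun b => a + b == dvec R d + intvec R w) C) C).
    move: Jw; rewrite -ab JformDr => Jab.
    have [Ja|Ja] := ltP (Jform d c a) 0.
      by exists a; rewrite // JcB // oppr_gt0.
    by exists b; rewrite // JcB // oppr_gt0; lra.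
  have [/eqP + _ _ _] := WA w wW; case; rewrite -coefW // /conv_coef.
  rewrite big_seq big1 // => a aC; rewrite big_seq_cond big1 // => b /andP[bC ab].
  by have /negP[] := nab a aC; apply/hasP; exists b.
(* [b] spans an edge of [conv C] at [c] entering the negative side. *)
move=> /(extremal_ray fC)[b [fb gb] [[e [eC ec eb]] ray]].
have fe := fC e eC ec.
have b_sum : \sum_i b ord0 i = 0.
  have := sumB e eC; rewrite eb sum_rowZ => /eqP.
  by rewrite mulf_eq0 gt_eqF //= => /eqP.
(* As [dot f b = 1], [h] is the parameter of a point on the line through [c] in direction [b]. *)
pose h a := dot f (a - c).
pose onray a := a - c == h a *: b.
have onrayP a : onray a -> a = c + h a *: b.
  by move=> /eqP <-; rewrite addrC subrK.
have hc : h c = 0 by rewrite /h subrr dot0r.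
have c_on : onray c by rewrite /onray hc scale0r subrr.
have h_inj a a' : onray a -> onray a' -> h a = h a' -> a = a'.
  by move=> /onrayP aE /onrayP a'E hE; rewrite aE hE -a'E.
have h_gt0 a : a \in C -> a != c -> 0 < h a by exact: fC.
have h_ge0 a : a \in C -> 0 <= h a.
  by move=> aC; have [->|/h_gt0-/(_ aC)/ltW//] := eqVneq a c; rewrite hc.
(* With parameters s and t, J is (s + t) J(c, b) + s t J(b, b), where J(c, b) < 0 and J(b, b) <=
   0. *)
have Jray a a' : onray a -> onray a' -> 0 <= h a -> 0 < h a' ->
    Jform d a a' < 0.
  move=> /onrayP + /onrayP +; move: (h a) (h a') => s t -> -> s0 t0.
  rewrite JformDl !JformDr !JformZl !JformZr Jcc (JformC d b c).
  rewrite (Jform_sum0 d c b_sum).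
  have tg : 0 < t * dot (J_dual d c) b by rewrite mulr_gt0.
  have sg : 0 <= s * dot (J_dual d c) b by rewrite mulr_ge0 // ltW.
  have := mulr_ge0_le0 (mulr_ge0 s0 (ltW t0)) (Jform_sum0_le0 d b_sum).
  lra.
have sum_on x y a a' : x \in C -> y \in C -> onray a -> onray a' ->
    x + y = a + a' -> [/\ onray x, onray y & h x + h y = h a + h a'].
  move=> xC yC /onrayP aE /onrayP a'E E.
  have E' : (x - c) + (y - c) = (h a + h a') *: b.
    rewrite addrACA E {1}aE {1}a'E; apply/rowP => i; rewrite !mxE; ring.
  have [xr yr] := ray x y _ xC yC E'; split; [exact/eqP|exact/eqP|].
  have := congr1 (dot f) E'; rewrite dotDr dotZr fb mulr1; exact.
(* Extremality of the ray reduces uniqueness of the representation to a comparison of heights. *)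
have edgeW a a' : a \in C -> a' \in C -> onray a -> onray a' -> 0 < h a' ->
    (forall x y, x \in C -> y \in C -> onray x -> onray y ->
       h x + h y = h a + h a' -> x = a \/ x = a') ->
    exists2 w, w \in W & a + a' = dvec R d + intvec R w.
  move=> aC a'C ra ra' ha' uniq.
  have [|k [kE k0]] := @conv_coef_unique R r d C F a a'.
    move=> x y xC yC E; have [rx ry hE] := sum_on x y a a' xC yC ra ra' E.
    have [xE|xE] := uniq x y xC yC rx ry hE; subst x; [left|right]; split=> //.
      exact: addrI E.
    by apply: (@addrI _ a'); rewrite E addrC.
  have [/hasP[v vW /eqP vE]|/hasPn nW] :=
    boolP (has (fun w => a + a' == dvec R d + intvec R w) W); first by exists v.
  have := coef0 (a + a') nW; rewrite kE => /eqP.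
  have J0 : Jform d a a' < 0 by apply: Jray => //; apply: h_ge0.
  rewrite !mulf_eq0 (lt_eqF J0) (negbTE (F0 a aC)) (negbTE (F0 a' a'C)) pnatr_eq0 /=.
  by rewrite eqn0Ngt k0.
have e_on : onray e by apply/eqP.
have eP : e \in [seq a <- C | onray a & a != c] by rewrite mem_filter e_on ec.
have [p + pmin] := seq_argmax (fun a => - h a) eP.
rewrite mem_filter => /andP[/andP[pr pc] pC].
have [q + qmax] := seq_argmax h eP.
rewrite mem_filter => /andP[/andP[qr qc] qC].
(* [m] is [c] itself when [q] is the only other point of [C] on the edge; then also [p = q]. *)
have cM : c \in [seq a <- C | onray a & a != q] by rewrite mem_filter c_on eq_sym qc.
have [m + mmax] := seq_argmax h cM.
rewrite mem_filter => /andP[/andP[mr mq] mC].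
have {}pmin a : a \in C -> onray a -> a != c -> h p <= h a.
  by move=> aC ar ac; rewrite -lerN2 pmin // mem_filter ar ac.
have {}mmax a : a \in C -> onray a -> a != q -> h a <= h m.
  by move=> aC ar aq; rewrite mmax // mem_filter ar aq.
have {}qmax a : a \in C -> onray a -> h a <= h q.
  move=> aC ar; have [->|ac] := eqVneq a c; first by rewrite hc h_ge0.
  by rewrite qmax // mem_filter ar ac.
have hp := h_gt0 p pC pc; have hq := h_gt0 q qC qc; have hm := h_ge0 m mC.
have hmq : h m < h q.
  rewrite lt_neqAle qmax // andbT; apply: contraNneq mq => E.
  exact/eqP/h_inj.
have [w0 w0W w0E] : exists2 w, w \in W & c + p = dvec R d + intvec R w.
  apply: edgeW => // y z yC zC yr zr; rewrite hc add0r => E.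
  have [->|yc] := eqVneq y c; [by left|right].
  apply: h_inj => //; have := pmin y yC yr yc; have := h_ge0 z zC; lra.
have [w2 w2W w2E] : exists2 w, w \in W & q + q = dvec R d + intvec R w.
  apply: edgeW => // y z yC zC yr zr E; left.
  apply: h_inj => //; have := qmax y yC yr; have := qmax z zC zr; lra.
have [w1 w1W w1E] : exists2 w, w \in W & m + q = dvec R d + intvec R w.
  apply: edgeW => // y z yC zC yr zr E.
  have [->|yq] := eqVneq y q; [by right|left].
  apply: h_inj => //; have := mmax y yC yr yq; have := qmax z zC zr; lra.
have [i Vb] : exists i, 0 < (c ord0 i *+ 2 - (d i)%:R) * b ord0 i.
  apply/existsP; apply: contraLR gb; rewrite negb_exists -leNgt => /forallP nV.
  (* Subtracting half of the zero sum of [b] gives each summand the sign of [(2 c_i - d_i) b_i]. *)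
  have -> : dot (J_dual d c) b = dot (J_dual d c) b - 2^-1 * \sum_i b ord0 i.
    by rewrite b_sum; ring.
  rewrite mulr_sumr -sumrB; apply: sumr_le0 => i _.
  have di : 0 < (d i)%:R :> R by rewrite ltr0n.
  have -> : J_dual d c ord0 i * b ord0 i - 2^-1 * b ord0 i =
      (c ord0 i *+ 2 - (d i)%:R) * b ord0 i * (2 * (d i)%:R)^-1.
    by rewrite mxE; field; rewrite gt_eqF.
  by rewrite mulr_le0_ge0 ?invr_ge0 ?mulr_ge0 // leNgt nV.
have coord y z v : onray y -> onray z -> y + z = dvec R d + intvec R v ->
    (v ord0 i)%:~R = c ord0 i *+ 2 - (d i)%:R + (h y + h z) * b ord0 i.
  move=> /onrayP yE /onrayP zE; rewrite {1}yE {1}zE => /rowP/(_ i).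
  rewrite !mxE; lra.
have /andP[w2l w2u] : -2 <= w2 ord0 i <= 1.
  by apply: type_bounds; have [] := WA w2 w2W.
have pq := qmax p pC pr.
(* If [h m + h q = h p], then [h p <= h q] and [0 <= h m] force [h q = h p], so the last parameter
   is twice the first. *)
apply: (@no_integer_progression R _ _ (h c + h p) (h m + h q) (h q + h q)
  _ _ _ _ _ _ _ Vb (coord _ _ _ c_on pr w0E) (coord _ _ _ mr qr w1E)
  (coord _ _ _ qr qr w2E) w2l w2u); rewrite ?hc; lra.
Qed.
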